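(* Let $n\ge 2$ and $n\le d\le 2n$ be integers. Then $$N_3(d,n;1)=3^{\dim_{\mathbb F_3}R_3(d,n)-1},$$ where $$\dim_{\mathbb F_3}R_3(d,n)=\sum_{0\le j\le\lfloor d/3\rfloor}(-1)^j\binom nj\binom{d-3j+n}n.$$
   Context: For a prime power $q=p^m$ ($p$ prime) and integers $n>0$, $0\le d\le n(q-1)$, the $q$-ary Reed-Muller code is $$R_q(d,n)=\{f\in\mathbb F_q[X_1,\dots,X_n]:\deg f\le d,\ \deg_{X_j}f\le q-1 \text{ for } 1\le j\le n\},$$ where $\deg$ is the total degree and $\deg_{X_j}$ is the degree in $X_j$ (the zero polynomial is included). The weight of $f\in R_q(d,n)$ is $|f|=q^n-|Z(f)|$, where $Z(f)=\{\boldsymbol x\in\mathbb F_q^n:f(\boldsymbol x)=0\}$. For $t\ge 0$, $N_q(d,n;t)=|\{f\in R_q(d,n):\nu_p(|f|)\ge t\}|$, where $\nu_p$ is the $p$-adic valuation ($\nu_p(0)=\infty$); that is, the number of codewords with weight divisible by $p^t$. *)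

(* Defs.v *)
From HB Require Import structures.
From mathcomp Require Import all_boot all_order all_algebra.
From mathcomp Require Import mpoly.

Set Implicit Arguments.
Unset Strict Implicit.
Unset Printing Implicit Defensive.

Import GRing.Theory.

Local Open Scope ring_scope.

(* Degree in the variable 'X_j; it is 0 for the zero polynomial. *)
Definition mdegX (R : nzRingType) (n : nat) (j : 'I_n) (f : {mpoly R[n]}) : nat :=
  \max_(m <- msupp f) m j.

(* [msize f] is the total degree plus one, and 0 for the zero polynomial. *)
Definition ReedMuller_pred (F : finFieldType) (d n : nat) : {pred {mpoly F[n]}} :=
  fun f => (msize f <= d.+1)%N && [forall j, (mdegX j f <= #|F| - 1)%N].
Arguments ReedMuller_pred : clear implicits.

Record ReedMuller (F : finFieldType) (d n : nat) : predArgType :=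
  MkReedMuller { RM_val :> {mpoly F[n]}; _ : RM_val \in ReedMuller_pred F d n }.

HB.instance Definition _ (F : finFieldType) (d n : nat) :=
  [isSub for @RM_val F d n].
HB.instance Definition _ (F : finFieldType) (d n : nat) :=
  [Choice of ReedMuller F d n by <:].

Section ReedMullerSpace.
Context (F : finFieldType) (d n : nat).

Lemma ReedMullerP (f : {mpoly F[n]}) :
  reflect (forall m, m \in msupp f ->
             (mdeg m < d.+1)%N && [forall j, (m j <= #|F| - 1)%N])
          (f \in ReedMuller_pred F d n).
Proof.
rewrite unfold_in; apply: (iffP andP) => [[hd /forallP hX] m hm | h].
  rewrite (leq_trans (msize_mdeg_lt hm) hd); apply/forallP => j.
  exact: leq_trans (leq_bigmax_seq _ hm isT) (hX j).
split.
  by rewrite msizeE; apply/bigmax_leqP_seq => m /h /andP[].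
apply/forallP => j; apply/bigmax_leqP_seq => m /h /andP[_ /forallP hX] _.
exact: hX.
Qed.

Lemma ReedMuller_submod : submod_closed (ReedMuller_pred F d n).
Proof.
split=> [|a f g /ReedMullerP hf /ReedMullerP hg]; apply/ReedMullerP => m.
  by rewrite msupp0.
move/msuppD_le; rewrite mem_cat => /orP[/msuppZ_le|]; [exact: hf | exact: hg].
Qed.

HB.instance Definition _ :=
  GRing.isSubmodClosed.Build F {mpoly F[n]} (ReedMuller_pred F d n)
    ReedMuller_submod.
HB.instance Definition _ :=
  [SubChoice_isSubLmodule of ReedMuller F d n by <:].

Definition RM_monomials : {set 'X_{1..n < d.+1}} :=
  [set m : 'X_{1..n < d.+1} | [forall j, ((m : 'X_{1..n}) j <= #|F| - 1)%N]].

Definition RM_monomial (i : 'I_#|RM_monomials|) : 'X_{1..n} := bmnm (enum_val i).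

Definition RM_coords (f : ReedMuller F d n) : 'rV[F]_#|RM_monomials| :=
  \row_i (val f)@_(RM_monomial i).

Definition RM_poly (r : 'rV[F]_#|RM_monomials|) : {mpoly F[n]} :=
  \sum_i r 0 i *: 'X_[RM_monomial i].

Lemma RM_monomial_inj : injective RM_monomial.
Proof. by move=> i j /val_inj /enum_val_inj. Qed.

Lemma RM_poly_in r : RM_poly r \in ReedMuller_pred F d n.
Proof.
apply: rpred_sum => i _; apply: rpredZ; apply/ReedMullerP => m.
rewrite msuppX inE => /eqP->; rewrite /RM_monomial.
by have := enum_valP i; rewrite inE => ->; rewrite bmdeg.
Qed.

Lemma RM_poly_coef r i : (RM_poly r)@_(RM_monomial i) = r 0 i.
Proof.
rewrite raddf_sum /= (bigD1 i) //= mcoeffZ mcoeffX eqxx mulr1 big1 ?addr0 //.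
by move=> j ji; rewrite mcoeffZ mcoeffX (inj_eq RM_monomial_inj) (negPf ji) mulr0.
Qed.

Lemma RM_coordsK : cancel RM_coords (fun r => MkReedMuller (RM_poly_in r)).
Proof.
move=> f; apply/val_inj/mpolyP => m /=.
case: (pickP [pred i | RM_monomial i == m]) => [i /eqP <- | hm].
  by rewrite RM_poly_coef mxE.
have -> : (RM_poly (RM_coords f))@_m = 0.
  rewrite raddf_sum big1 // => i _ /=.
  by rewrite mcoeffZ mcoeffX [_ == m]hm mulr0.
apply/esym/eqP; rewrite mcoeff_eq0; apply/negP => mf.
have /ReedMullerP/(_ m mf)/andP[md mX] := valP f.
have mI : BMultinom md \in RM_monomials by rewrite inE.
have := hm (enum_rank_in mI (BMultinom md)).
by rewrite /= /RM_monomial enum_rankK_in // eqxx.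
Qed.

Lemma RM_vect_axiom : Vector.axiom #|RM_monomials| (ReedMuller F d n).
Proof.
exists RM_coords; first by move=> a f g; apply/rowP => i; rewrite !mxE linearP.
exists (fun r => MkReedMuller (RM_poly_in r)); first exact: RM_coordsK.
by move=> r; apply/rowP => i; rewrite mxE RM_poly_coef.
Qed.

HB.instance Definition _ :=
  Lmodule_hasFinDim.Build F (ReedMuller F d n) RM_vect_axiom.
HB.instance Definition _ :=
  PCanIsCountable (can_pcan RM_coordsK : pcancel _ _).
HB.instance Definition _ : isFinite (ReedMuller F d n) := CanIsFinite RM_coordsK.

End ReedMullerSpace.

Section Weight.
Context (F : finFieldType).

Definition zero_set (n : nat) (f : {mpoly F[n]}) : {set {ffun 'I_n -> F}} :=
  [set x : {ffun 'I_n -> F} | f.@[x] == 0].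

Definition weight (n : nat) (f : {mpoly F[n]}) : nat :=
  (#|F| ^ n - #|zero_set f|)%N.

(* [pdiv #|F|] is the prime p of which #|F| is a power. The condition
   "valuation at least t" is written as divisibility by p ^ t because
   [logn p 0 = 0], whereas the valuation of 0 is infinite: the zero codeword,
   of weight 0, must be counted. *)
Definition weight_count (d n t : nat) : nat :=
  #|[set f : ReedMuller F d n | (pdiv #|F| ^ t %| weight f)%N]|.

End Weight.
Arguments weight_count : clear implicits.

(* Main.v *)
Require Import Defs.
From mathcomp Require Import all_boot all_order all_algebra.
From mathcomp Require Import mpoly.

Import GRing.Theory.

Local Open Scope ring_scope.

(** Since a ^ 2 is 0 or 1 for every a in F_3, the weight of f is congruent
    modulo 3 to Q(f) = \sum_x f(x) ^ 2, so the codewords to be counted are the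
    zeros of a quadratic form on the code. The form is easy to read in the basis
    of the products e_m = \prod_i e_(m_i)(X_i), where e_0 = 1, e_1 = X and
    e_2 = X ^ 2 + 1: the sum of e_k e_l over F_3 is -1 if k + l = 2 and 0
    otherwise, so that e_m is orthogonal to every e_m' except for m' = 2 - m
    ([sum_adapted_monomial]). Moreover e_m has the same degrees as X ^ m, so the
    e_m with m an exponent of the code form a basis of it
    ([adapted_codeword_bij]).

    Up to sign, Q is therefore the sum of the products r_m r_(2 - m), over the m
    such that m and 2 - m both have degree at most d. The involution m |-> 2 - m
    has a single fixed point, the exponent (1, .., 1) of degree n <= d; hence
    Q = r_1 ^ 2 + H, where H gets negated when the coordinates on one side of the
    pairs {m, 2 - m} change sign. By this symmetry H takes the values 1 and -1
    equally often, while r_1 ^ 2 = - H has one solution r_1 if H = 0, two if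
    H = -1 and none if H = 1. There are thus as many zeros of Q as there are
    values of the coordinates other than r_1, that is 3 ^ (N - 1) where N is the
    dimension ([card_matching_form_zeros]).

    As for the dimension over a field with q elements, the number of
    exponents in {0, .., q - 1}^n of sum at most d is the coefficient of X ^ d
    in (1 + X + .. + X ^ (q - 1)) ^ n / (1 - X), that is in
    (1 - X ^ q) ^ n / (1 - X) ^ (n + 1), which the binomial theorem expands
    ([coef_geometric_pow]). *)

(** * The dimension of Reed-Muller codes *)

Definition eq_upto (d : nat) (p q : {poly int}) :=
  forall k, (k <= d)%N -> p`_k = q`_k.

Lemma eq_uptoMl d r p q : eq_upto d p q -> eq_upto d (r * p) (r * q).
Proof.
move=> pq k kd; rewrite !coefM; apply: eq_bigr => i _; rewrite pq //.
exact: leq_trans (leq_subr _ _) kd.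
Qed.

(** The power series 1 / (1 - X) ^ (b + 1), truncated after degree d. *)
Definition binseries (d b : nat) : {poly int} := \poly_(k < d.+1) 'C(k + b, b)%:R.

Lemma binseriesS d b :
  eq_upto d ((1 - 'X) * binseries d b.+1) (binseries d b).
Proof.
move=> k kd; rewrite mulrBl mul1r coefB coefXM !coef_poly ltnS kd.
case: k kd => [|k] kd /=; first by rewrite !add0n !binn subr0.
by rewrite ltnS (ltnW kd) addSn binS natrD -addSnnS addrC addKr.
Qed.

Lemma binseries_pow d b :
  eq_upto d ((1 - 'X) ^+ b * binseries d b) (binseries d 0).
Proof.
elim: b => [|b IHb] k kd; first by rewrite mul1r.
by rewrite exprSr -mulrA (eq_uptoMl _ _ _ _ (binseriesS d b)) // IHb.
Qed.

(** Multiplying by 1 / (1 - X) amounts to summing the coefficients up to the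
    given one; here the series is truncated after degree d. *)
Lemma card_bounded_digits (n q d : nat) :
  #|[set g : {ffun 'I_n -> 'I_q} | (\sum_i g i <= d)%N]|%:Z =
  ((\sum_(t < q) 'X^t) ^+ n * \sum_(k < d.+1) 'X^k : {poly int})`_d.
Proof.
have -> p : p ^+ n = \prod_(i < n) p :> {poly int}.
  by rewrite prodr_const card_ord.
rewrite bigA_distr_bigA /= mulr_suml coef_sum.
rewrite -sum1_card -natz big_mkcond natr_sum.
apply: eq_bigr => g _; rewrite prodrXr coefXnM.
rewrite inE leqNgt; case: ltnP => [gd|gd] /=; first by [].
have gk : (d - \sum_i g i < d.+1)%N by rewrite ltnS leq_subr.
rewrite coef_sum (bigD1 (Ordinal gk)) //= coefXn eqxx big1 ?addr0 // => k.
by rewrite -val_eqE coefXn /= eq_sym => /negPf ->.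
Qed.

(** The sum being multiplied agrees up to degree d with
    (1 - X) ^ n / (1 - X) ^ (n + 1), and the factor (1 - X) ^ n turns the
    geometric sums into (1 - X ^ q) ^ n. *)
Lemma coef_geometric_pow (q n d : nat) : (0 < q)%N ->
  ((\sum_(t < q) 'X^t) ^+ n * \sum_(k < d.+1) 'X^k : {poly int})`_d =
  \sum_(0 <= j < (d %/ q).+1)
     (-1) ^+ j * 'C(n, j)%:Z * 'C(d - q * j + n, n)%:Z.
Proof.
move=> q_gt0.
have -> : \sum_(k < d.+1) 'X^k = binseries d 0.
  rewrite /binseries poly_def; apply: eq_bigr => i _.
  by rewrite addn0 bin0 scale1r.
rewrite -(eq_uptoMl _ _ _ _ (binseries_pow d n)) // mulrA -exprMn.
have -> : (\sum_(t < q) 'X^t) * (1 - 'X) = 1 - 'X^q :> {poly int}.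
  by rewrite -opprB mulrN mulrC -subrX1 opprB.
rewrite exprBn mulr_suml coef_sum.
(* The two sums end at n and at d %/ q: both are cut out of a common range. *)
have -> (r : nat -> int) : \sum_(0 <= j < (d %/ q).+1) r j
    = \sum_(j < (d %/ q + n).+1 | (j <= d %/ q)%N) r j.
  by rewrite big_mkord (big_ord_widen (d %/ q + n).+1 r) // ltnS leq_addr.
rewrite (big_ord_widen (d %/ q + n).+1
  (fun j => (((-1) ^+ j * 1 ^+ (n - j) * 'X^q ^+ j *+ 'C(n, j))
     * binseries d n)`_d)) ?ltnS ?leq_addl //.
rewrite big_mkcond [RHS]big_mkcond /=; apply: eq_bigr => j _.
have -> : (-1) ^+ j = ((-1) ^+ j)%:P :> {poly int}.
  by rewrite rmorphXn rmorphN1.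
rewrite expr1n mulr1 !ltnS leq_divRL // mulnC mulrnAl coefMn -mulrA coefCM.
rewrite -exprM coefXnM.
have [qjd|qjd] := leqP (q * j) d; last by rewrite mulr0 mul0rn; case: ifP.
rewrite coef_poly ltnS leq_subr.
have [jn|jn] := leqP j n; last by rewrite bin_small // mulr0 mul0r.
by rewrite natz mulrAC -mulr_natr natz.
Qed.

Lemma card_RM_monomials (F : finFieldType) (d n : nat) :
  #|RM_monomials F d n| =
  #|[set g : {ffun 'I_n -> 'I_#|F|} | (\sum_i g i <= d)%N]|.
Proof.
have F_gt0 : (0 < #|F|)%N by apply/card_gt0P; exists 0.
pose digits (m : 'X_{1..n < d.+1}) : {ffun 'I_n -> 'I_#|F|} :=
  [ffun k => insubd (Ordinal F_gt0) (m k)].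
have digitsE m k : m \in RM_monomials F d n -> digits m k = m k :> nat.
  rewrite inE => /forallP/(_ k); rewrite leq_subRL // add1n => mk.
  by rewrite ffunE insubdK.
rewrite -(card_in_imset (f := digits)) => [|m m' mM m'M mm']; last first.
  by apply/val_inj/mnmP => k; rewrite -!digitsE // mm'.
apply: eq_card => g; rewrite inE; apply/imsetP/idP => [[m mM ->]|g_d].
  have := bmdeg m; rewrite ltnS mdegE.
  by congr (_ <= _)%N; apply: eq_bigr => k _; rewrite digitsE.
have md : (mdeg [multinom (g k : nat) | k < n] < d.+1)%N.
  by rewrite ltnS mdegE; under eq_bigr do rewrite mnmE.
have mM : BMultinom md \in RM_monomials F d n.
  by rewrite inE; apply/forallP => k; rewrite mnmE leq_subRL // add1n.
exists (BMultinom md) => //.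
by apply/ffunP => k; apply/ord_inj; rewrite digitsE // mnmE.
Qed.

Lemma dim_ReedMuller (F : finFieldType) (n d : nat) :
  (\dim {:ReedMuller F d n})%:Z =
  \sum_(0 <= j < (d %/ #|F|).+1)
     (-1) ^+ j * 'C(n, j)%:Z * 'C(d - #|F| * j + n, n)%:Z.
Proof.
rewrite dimvf [dim _]card_RM_monomials card_bounded_digits coef_geometric_pow //.
by apply/card_gt0P; exists 0.
Qed.

(** * Zeros of the sum of a square and a form equivalent to its opposite *)

(** Subtracting h r from the i0-th coordinate of r is bijective, because h does
    not see that coordinate; this maps the set to a coordinate hyperplane. *)
Lemma card_ffun_graph (I : finType) (F : finZmodType) (i0 : I)
    (h : {ffun I -> F} -> F) :
    (forall r r' : {ffun I -> F},
       (forall i, i != i0 -> r i = r' i) -> h r = h r') ->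
  #|[set r : {ffun I -> F} | r i0 == h r]| = (#|F| ^ (#|I| - 1))%N.
Proof.
move=> h_indep.
pose shift (r : {ffun I -> F}) : {ffun I -> F} :=
  [ffun i => if i == i0 then r i - h r else r i].
pose unshift (r : {ffun I -> F}) : {ffun I -> F} :=
  [ffun i => if i == i0 then r i + h r else r i].
have h_shift r : h (shift r) = h r.
  by apply: h_indep => i /negPf i_i0; rewrite ffunE i_i0.
have h_unshift r : h (unshift r) = h r.
  by apply: h_indep => i /negPf i_i0; rewrite ffunE i_i0.
have shiftK : cancel shift unshift.
  move=> r; apply/ffunP => i; rewrite !ffunE h_shift.
  by case: eqP => // _; rewrite subrK.
have unshiftK : cancel unshift shift.
  move=> r; apply/ffunP => i; rewrite !ffunE h_unshift.
  by case: eqP => // _; rewrite addrK.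
rewrite subn1 -(cardC1 i0) -(card_pffun_on (0 : F) (predC1 i0) predT).
rewrite -(on_card_preimset (R := pffun_on _ _ _) (f := shift)); last first.
  by apply: onW_bij; exists unshift.
apply: eq_card => r; rewrite !inE -subr_eq0.
apply/eqP/familyP => [r0 i|/(_ i0)]; rewrite !inE ffunE ?eqxx.
- by case: eqP => [->|//]; rewrite r0 inE.
- by move/eqP.
Qed.

Lemma F3_cases (a : 'F_3) : [\/ a = 0, a = 1 | a = -1].
Proof.
by case: a => [[|[|[|//]]] lt_a3];
  [constructor 1|constructor 2|constructor 3]; apply/val_inj.
Qed.

Lemma sum_F3 (V : nmodType) (E : 'F_3 -> V) : \sum_a E a = E 0 + E 1 + E (-1).
Proof.
rewrite !big_ord_recl big_ord0 addr0 addrA.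
by do ![congr (_ + _)]; congr (E _); apply/val_inj.
Qed.

(** The relation b is meant to be a partial matching whose only loop is at i0,
    and s to select one end of each of its other edges. *)
Section MatchingForm.
Context (I : finType) (i0 : I) (b : rel I) (s : pred I).
Context (b00 : b i0 i0).
Context (b0l : forall j, b i0 j -> j = i0).
Context (b0r : forall i, b i i0 -> i = i0).
Context (bs : forall i j, i != i0 -> b i j -> s j = ~~ s i).
Implicit Types r : {ffun I -> 'F_3}.

Definition matching_form r : 'F_3 := \sum_i \sum_(j | b i j) r i * r j.

Definition matching_tail r : 'F_3 :=
  \sum_(i | i != i0) \sum_(j | b i j) r i * r j.

Definition flip r : {ffun I -> 'F_3} :=
  [ffun i => if (i != i0) && s i then - r i else r i].

Lemma matching_formE r : matching_form r = r i0 ^+ 2 + matching_tail r.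
Proof.
rewrite /matching_form (bigD1 i0) //=; congr (_ + _).
rewrite (bigD1 i0) //= big1 ?addr0 // => j /andP[/b0l ->].
by rewrite eqxx.
Qed.

Lemma matched_neq i j : i != i0 -> b i j -> j != i0.
Proof.
by move=> + bij; apply: contra_neq => j0; move: bij; rewrite j0 => /b0r.
Qed.

Lemma matching_tail_indep r r' :
  (forall i, i != i0 -> r i = r' i) -> matching_tail r = matching_tail r'.
Proof.
move=> rr'; apply: eq_bigr => i i_i0; apply: eq_bigr => j bij.
by rewrite !rr' //; apply: matched_neq bij.
Qed.

Lemma flipK : involutive flip.
Proof.
move=> r; apply/ffunP => i; rewrite !ffunE.
by case: ifP => s_i; rewrite ?s_i ?opprK.
Qed.

Lemma flip0 r : flip r i0 = r i0.
Proof. by rewrite ffunE eqxx. Qed.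

Lemma matching_tail_flip r : matching_tail (flip r) = - matching_tail r.
Proof.
rewrite /matching_tail -sumrN; apply: eq_bigr => i i_i0.
rewrite -sumrN; apply: eq_bigr => j bij.
rewrite !ffunE i_i0 (matched_neq _ _ i_i0 bij) (bs _ _ i_i0 bij) /=.
by case: (s i); rewrite ?mulNr ?mulrN.
Qed.

(** Applying [flip] exactly when r i0 = -1 linearizes the equation
    r i0 ^ 2 = - matching_tail r into r i0 = - matching_tail r: the two agree
    for r i0 = 0 and r i0 = 1, and for r i0 = -1 they differ by the sign of the
    tail. *)
Lemma card_matching_form_zeros :
  #|[set r | matching_form r == 0]| = (3 ^ (#|I| - 1))%N.
Proof.
pose fold (r : {ffun I -> 'F_3}) := if r i0 == -1 then flip r else r.
have fold0 r : fold r i0 = r i0 by rewrite /fold; case: ifP; rewrite ?flip0.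
have foldK : involutive fold.
  move=> r; rewrite {1}/fold fold0 /fold.
  by case: ifP => fold_r; rewrite fold_r ?flipK.
rewrite -[X in (X ^ _)%N](card_Fp (p := 3)) //.
rewrite -(@card_ffun_graph I 'F_3 i0 (fun r => - matching_tail r)); last first.
  by move=> r r' /matching_tail_indep ->.
rewrite -[RHS](on_card_preimset (f := fold)); last first.
  by apply: onW_bij; apply: inv_bij.
apply: eq_card => r; rewrite !inE fold0 /fold matching_formE.
have [->|->|->] := F3_cases (r i0).
- by rewrite expr0n add0r -[RHS]eqr_opp oppr0 opprK eq_sym.
- by rewrite /= expr1n -[RHS]subr_eq0 opprK.
- rewrite eqxx /= matching_tail_flip opprK sqrrN expr1n.
  by rewrite -[RHS]eqr_opp opprK addr_eq0.
Qed.
End MatchingForm.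

(** * A basis adapted to the weight modulo 3 *)

(** For k <= 2, the polynomials 1, X and X ^ 2 + 1. The constant added to X ^ 2
    makes the sum of (X ^ 2 + 1) ^ 2 over F_3 vanish, unlike that of X ^ 4. *)
Definition adapted_factor (R : nzRingType) (k : nat) (x : R) : R :=
  x ^+ k + (k == 2)%:R.
Arguments adapted_factor {R}.

Lemma sum_adapted_factor (k l : nat) : (k <= 2)%N -> (l <= 2)%N ->
  \sum_(a : 'F_3) adapted_factor k a * adapted_factor l a = - (k + l == 2)%:R.
Proof.
by case: k => [|[|[|//]]] _; case: l => [|[|[|//]]] _;
  rewrite sum_F3; apply/val_inj.
Qed.

Section AdaptedMonomial.
Context (n : nat).
Implicit Types m : 'X_{1..n}.

Definition adapted_monomial (R : comNzRingType) m : {mpoly R[n]} :=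
  \prod_i adapted_factor (m i) 'X_i.

Lemma meval_adapted_monomial (R : comNzRingType) m (x : 'I_n -> R) :
  (adapted_monomial R m).@[x] = \prod_i adapted_factor (m i) (x i).
Proof.
rewrite rmorph_prod; apply: eq_bigr => i _.
by rewrite rmorphD rmorphXn rmorph_nat /= mevalXU.
Qed.

Lemma sum_adapted_monomial m m' :
    (forall i, m i <= 2)%N -> (forall i, m' i <= 2)%N ->
  \sum_(x : {ffun 'I_n -> 'F_3})
      (adapted_monomial 'F_3 m).@[x] * (adapted_monomial 'F_3 m').@[x]
    = (-1) ^+ n * [forall i, (m i + m' i == 2)%N]%:R.
Proof.
move=> m2 m'2.
under eq_bigr do rewrite !meval_adapted_monomial -big_split /=.
rewrite -(bigA_distr_bigA
  (fun i a => adapted_factor (m i) a * adapted_factor (m' i) a)) /=.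
under eq_bigr do rewrite sum_adapted_factor //.
rewrite prodrN card_ord; congr (_ * _); rewrite -natr_prod; congr (_%:R).
case: forallP => [mm'|]; first by rewrite big1 // => i _; rewrite mm'.
move/forallP; rewrite negb_forall => /existsP[i /negPf mi].
by rewrite (bigD1 i) //= mi mul0n.
Qed.

Definition bounded_support (R : nzRingType) (p : {mpoly R[n]}) m :=
  {in msupp p, forall m', (m' <= m)%MM}.

Lemma bounded_supportM (R : nzRingType) (p q : {mpoly R[n]}) m m' :
  bounded_support R p m -> bounded_support R q m' ->
  bounded_support R (p * q) (m + m')%MM.
Proof.
move=> pm qm' _ /msuppM_le/allpairsP[[a b] [/= /pm am /qm' bm' ->]].
apply/mnm_lepP => i; rewrite !mnmDE.
by apply: leq_add; [move/mnm_lepP: am | move/mnm_lepP: bm'].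
Qed.

Lemma bounded_support1 (R : nzRingType) m : bounded_support R 1 m.
Proof.
by move=> m'; rewrite msupp1 inE => /eqP ->; apply/mnm_lepP => i; rewrite mnm0E.
Qed.

Lemma bounded_support_factor (R : nzRingType) (i : 'I_n) (k : nat) :
  bounded_support R (adapted_factor k 'X_i) (U_(i) *+ k)%MM.
Proof.
move=> m'; rewrite /adapted_factor mpolyXn => /msuppD_le.
rewrite mem_cat msuppX inE => /orP[/eqP -> //|]; first exact: lepm_refl.
by case: (k == 2)%N; [exact: bounded_support1 | rewrite msupp0].
Qed.

Lemma bounded_support_adapted (R : comNzRingType) m :
  bounded_support R (adapted_monomial R m) m.
Proof.
have {2}-> : m = (\sum_i U_(i) *+ m i)%MM.
  apply/mnmP => j; rewrite mnm_sumE (bigD1 j) //= mulmnE mnm1E eqxx mul1n.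
  rewrite big1 ?addn0 // => i /negPf ij.
  by rewrite mulmnE mnm1E ij mul0n.
rewrite /adapted_monomial; elim/big_ind2 : _ => [|p a q b|i _].
- exact: bounded_support1.
- exact: bounded_supportM.
- exact: bounded_support_factor.
Qed.

Lemma adapted_monomial_RM (F : finFieldType) (d : nat) m :
    (mdeg m <= d)%N -> (forall i, m i <= #|F| - 1)%N ->
  adapted_monomial F m \in ReedMuller_pred F d n.
Proof.
move=> md mF; apply/ReedMullerP => m' /bounded_support_adapted/mnm_lepP m'm.
rewrite ltnS (leq_trans _ md) /=; last by rewrite !mdegE; apply: leq_sum => i _.
by apply/forallP => i; apply: leq_trans (mF i).
Qed.
End AdaptedMonomial.

(** * Ternary codewords of weight divisible by 3 *)

Lemma natr_weight_F3 (n : nat) (f : {mpoly 'F_3[n]}) :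
  (weight f)%:R = \sum_(x : {ffun 'I_n -> 'F_3}) f.@[x] ^+ 2 :> 'F_3.
Proof.
have -> : weight f = #|~: zero_set f|.
  by rewrite cardsCs setCK /weight card_ffun !card_ord.
rewrite -sum1_card natr_sum big_mkcond; apply: eq_bigr => x _.
rewrite !inE; have [->|->|->] := F3_cases f.@[x].
- by rewrite eqxx expr0n.
- by rewrite /= expr1n.
- by rewrite /= sqrrN expr1n.
Qed.

Lemma dvd3_weightE (n : nat) (f : {mpoly 'F_3[n]}) :
  (3 %| weight f)%N = (\sum_(x : {ffun 'I_n -> 'F_3}) f.@[x] ^+ 2 == 0).
Proof. by rewrite -natr_weight_F3 (dvdn_pcharf (pchar_Fp _)). Qed.

Section AdaptedCoordinates.
Context (n d : nat).
Notation N := #|RM_monomials 'F_3 d n|.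
Implicit Types (i j : 'I_N) (r : {ffun 'I_N -> 'F_3}).

Lemma RM_monomial_le2 i k : (RM_monomial i k <= 2)%N.
Proof. by have := enum_valP i; rewrite inE card_Fp // => /forallP/(_ k). Qed.

Lemma mdeg_RM_monomial i : (mdeg (RM_monomial i) <= d)%N.
Proof. by rewrite -ltnS bmdeg. Qed.

Definition adapted_poly r : {mpoly 'F_3[n]} :=
  \sum_i r i *: adapted_monomial n 'F_3 (RM_monomial i).

Lemma adapted_poly_RM r : adapted_poly r \in ReedMuller_pred 'F_3 d n.
Proof.
apply: rpred_sum => i _; apply: rpredZ; apply: adapted_monomial_RM.
  exact: mdeg_RM_monomial.
by move=> k; rewrite card_Fp // RM_monomial_le2.
Qed.

Definition adapted_codeword r : ReedMuller 'F_3 d n :=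
  MkReedMuller (adapted_poly_RM r).

(** The dual exponent 2 - m may have degree greater than d, so the coordinates
    are recovered by pairing with polynomials outside the code. *)
Lemma adapted_poly_coef r i :
  \sum_(x : {ffun 'I_n -> 'F_3}) (adapted_poly r).@[x] *
     (adapted_monomial n 'F_3 [multinom 2 - RM_monomial i k | k < n]).@[x]
  = (-1) ^+ n * r i.
Proof.
have dual_le2 k : ([multinom 2 - RM_monomial i k | k < n] k <= 2)%N.
  by rewrite mnmE leq_subr.
under eq_bigr => x _ do rewrite raddf_sum /= mulr_suml.
rewrite exchange_big /= (bigD1 i) //= [X in _ + X]big1 ?addr0 => [|j j_i].
  under eq_bigr => x _ do rewrite mevalZ -mulrA.
  rewrite -mulr_sumr sum_adapted_monomial //; last exact: RM_monomial_le2.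
  rewrite mulrCA; case: forallP => [_|[]]; first by rewrite mulr1.
  by move=> k; rewrite mnmE subnKC ?RM_monomial_le2.
under eq_bigr => x _ do rewrite mevalZ -mulrA.
rewrite -mulr_sumr sum_adapted_monomial //; last exact: RM_monomial_le2.
case: forallP => [ji|]; last by rewrite !mulr0.
case/eqP: j_i; apply/RM_monomial_inj/mnmP => k.
have := RM_monomial_le2 i k; move: (ji k); rewrite mnmE => /eqP.
by move=> /(canRL (addnK _)) ->; apply: subKn.
Qed.

Lemma adapted_poly_inj : injective adapted_poly.
Proof.
move=> r r' rr'; apply/ffunP => i.
have := adapted_poly_coef r i; rewrite rr' adapted_poly_coef.
by move/(mulrI _) => -> //; rewrite unitrX ?unitrN1.
Qed.

(** The basis has as many elements as there are monomials in the code, so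
    injectivity is enough and the triangular change of basis is never
    inverted. *)
Lemma adapted_codeword_bij : bijective adapted_codeword.
Proof.
apply: inj_card_bij => [r r' /(congr1 val)/adapted_poly_inj //|].
have := leq_card _ (can_inj (@RM_coordsK 'F_3 d n)).
by rewrite card_mx mul1n card_ffun !card_ord.
Qed.

Definition dual : rel 'I_N :=
  fun i j => [forall k, RM_monomial i k + RM_monomial j k == 2]%N.

Lemma dualC i j : dual i j = dual j i.
Proof. by apply: eq_forallb => k; rewrite addnC. Qed.

Lemma dual_inj i j j' : dual i j -> dual i j' -> j = j'.
Proof.
move=> /forallP ij /forallP ij'; apply/RM_monomial_inj/mnmP => k.
by apply: (@addnI (RM_monomial i k)); rewrite (eqP (ij k)) (eqP (ij' k)).
Qed.

Lemma sum_adapted_poly_sqr r :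
  \sum_(x : {ffun 'I_n -> 'F_3}) (adapted_poly r).@[x] ^+ 2
  = (-1) ^+ n * matching_form 'I_N dual r.
Proof.
under eq_bigr => x _ do rewrite expr2 !raddf_sum /= big_distrlr /=.
rewrite exchange_big /= mulr_sumr; apply: eq_bigr => i _.
rewrite exchange_big /= [in RHS]big_mkcond mulr_sumr; apply: eq_bigr => j _.
under eq_bigr => x _ do rewrite !mevalZ mulrACA.
rewrite -mulr_sumr sum_adapted_monomial; try exact: RM_monomial_le2.
rewrite -/(dual i j) mulrCA; congr (_ * _).
by case: (dual i j); rewrite ?mulr1 ?mulr0.
Qed.

Lemma dvd3_weight_adapted r :
  (3 %| weight (adapted_codeword r))%N = (matching_form 'I_N dual r == 0).
Proof.
rewrite dvd3_weightE sum_adapted_poly_sqr mulrI_eq0 //.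
by apply/lregX/mulrI; rewrite unitrN1.
Qed.

Lemma ones_RM_monomial :
  (n <= d)%N -> exists i0 : 'I_N, forall k, RM_monomial i0 k = 1%N.
Proof.
move=> nd.
have md : (mdeg [multinom 1%N | k < n] < d.+1)%N.
  rewrite ltnS mdegE; under eq_bigr do rewrite mnmE.
  by rewrite sum1_card card_ord.
have mM : BMultinom md \in RM_monomials 'F_3 d n.
  by rewrite inE; apply/forallP => k; rewrite mnmE card_Fp.
exists (enum_rank_in mM (BMultinom md)) => k.
by rewrite /RM_monomial enum_rankK_in //= mnmE.
Qed.

Lemma weight_count3E :
  (n <= d)%N -> weight_count 'F_3 d n 1 = (3 ^ (N - 1))%N.
Proof.
move=> /ones_RM_monomial[i0 i0E].
have dual0 : dual i0 i0 by apply/forallP => k; rewrite i0E.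
(* The side of i in its pair {i, j} is given by the order of the indices. *)
pose s i := [exists j, dual i j && (i < j)%N].
rewrite -[in RHS](card_ord N) -(@card_matching_form_zeros 'I_N i0 dual s) //.
- rewrite /weight_count -(on_card_preimset (onW_bij _ adapted_codeword_bij)).
  by apply: eq_card => r; rewrite !inE card_Fp // expn1 dvd3_weight_adapted.
- by move=> j /dual_inj/(_ dual0).
- by move=> i; rewrite dualC => /dual_inj/(_ dual0).
move=> i j i_i0 ij.
have sE i' j' : dual i' j' -> s i' = (i' < j')%N.
  move=> ij'; apply/existsP/idP => [[k /andP[/dual_inj/(_ ij') ->]] //|lt_ij'].
  by exists j'; rewrite ij'.
rewrite (sE i j) // (sE j i) ?(dualC j) // -leqNgt [RHS]leq_eqVlt (inj_eq (@ord_inj _)).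
have [ji|//] := eqVneq j i.
case/eqP: i_i0; apply/RM_monomial_inj/mnmP => k.
move: ij; rewrite ji => /forallP/(_ k); rewrite i0E.
by case: (RM_monomial i k) => [|[|[|m]]].
Qed.
End AdaptedCoordinates.

Theorem corollary3p6 (n d : nat) (hn : (2 <= n)%N) (hd : (n <= d <= 2 * n)%N) :
  weight_count 'F_3 d n 1 = (3 ^ (\dim {:ReedMuller 'F_3 d n} - 1))%N
  /\ (\dim {:ReedMuller 'F_3 d n})%:Z
     = \sum_(0 <= j < (d %/ 3).+1)
         (-1) ^+ j * 'C(n, j)%:Z * 'C(d - 3 * j + n, n)%:Z.
Proof.
have /andP[nd _] := hd.
split; first by rewrite weight_count3E // dimvf.
by rewrite dim_ReedMuller card_Fp.
Qed.
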